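(* Let $\mathscr{C}$ be one of $\mathbf{DL}$, $\mathbf{BDL}$, $\mathbf{BA}$, and let $V$ be a set of propositional variables. Let $\mathcal{L}_{FC}$ be the quotient of the free $L_{\mathrm{RL}}$-algebra over the free $\mathscr{C}$-object on $V$ by the fully invariant congruence generated by the axioms FC1–FC6 listed in the context. Let $\Phi,\Psi$ be sets of formulas such that there are no finite $\Phi_0\subseteq\Phi$ and $\Psi_0\subseteq\Psi$ with $[\bigwedge\Phi_0]\le[\bigvee\Psi_0]$ in $\mathcal{L}_{FC}$. Here $\bigwedge\emptyset=\top$ and $\bigvee\emptyset=\bot$ when $\mathscr{C}$ is $\mathbf{BDL}$ or $\mathbf{BA}$, and only nonempty sets are considered when $\mathscr{C}=\mathbf{DL}$. Then there exist a $T_{\mathrm{RL}}$-coalgebra $\gamma:W\to T_{\mathrm{RL}}W$ validating FC1–FC6, a valuation $v$, and a point $w\in W$ with $w\in[\![a]\!]$ for all $a\in\Phi$ and $w\notin[\![b]\!]$ for all $b\in\Psi$.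
   Context: $\mathbf{DL}$, $\mathbf{BDL}$, $\mathbf{BA}$ denote respectively distributive lattices (not necessarily bounded), bounded distributive lattices, and Boolean algebras. Formulas are terms built from the variables in $V$ using the lattice operations of $\mathscr{C}$ (that is, $\wedge,\vee$, plus $\top,\bot$ for $\mathbf{BDL}$, plus $\top,\bot,\neg$ for $\mathbf{BA}$), a constant $I$, and binary operations $\otimes,\backslash,/$. An $L_{\mathrm{RL}}$-algebra is an object $A$ of $\mathscr{C}$ with operations $I,\otimes,\backslash,/$ satisfying, for every finite $X\subseteq A$ and every $a\in A$, the laws below. $X$ must be nonempty if $\mathscr{C}=\mathbf{DL}$; otherwise $\bigvee\emptyset=\bot$ and $\bigwedge\emptyset=\top$. - $(\bigvee X)\otimes a=\bigvee_{x\in X}(x\otimes a)$ - $a\otimes\bigvee X=\bigvee_{x\in X}(a\otimes x)$ - $a\backslash\bigwedge X=\bigwedge_{x\in X}(a\backslash x)$ - $(\bigvee X)\backslash a=\bigwedge_{x\in X}(x\backslash a)$ - $(\bigwedge X)/a=\bigwedge_{x\in X}(x/a)$ - $a/\bigvee X=\bigwedge_{x\in X}(a/x)$ Axioms (an inequation $s\le t$ means $s\wedge t=s$): - FC1: $a\otimes I=a$ and $I\otimes a=a$. - FC2: $I\le a\backslash a$ and $I\le a/a$. - FC3: $a\otimes(b\backslash c)\le(a\otimes b)\backslash c$. - FC4: $(c/b)\otimes a\le c/(a\otimes b)$. - FC5: $(a/b)\otimes b\le a$. - FC6: $b\otimes(b\backslash a)\le a$. Semantics. When $\mathscr{C}$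 is $\mathbf{DL}$ or $\mathbf{BDL}$, $W$ ranges over posets; when $\mathscr{C}=\mathbf{BA}$, $W$ ranges over discrete posets. $W^{\mathrm{op}}$ is the opposite order, and products are ordered componentwise. A subset $U$ is convex if $x,z\in U$ and $x\le y\le z$ imply $y\in U$. $\mathsf{P}_c(W)$ is the set of convex subsets of $W$ with the Egli–Milner order: $U\le U'$ iff every $u\in U$ has some $u'\in U'$ with $u\le u'$, and every $u'\in U'$ has some $u\in U$ with $u\le u'$. $\mathbf{2}=\{0,1\}$ is ordered by $1\le0$. $T_{\mathrm{RL}}W=\mathbf{2}\times\mathsf{P}_c(W\times W)\times\mathsf{P}_c(W^{\mathrm{op}}\times W)\times\mathsf{P}_c(W\times W^{\mathrm{op}})$ with the product order. A $T_{\mathrm{RL}}$-coalgebra is a monotone map $\gamma=(\gamma_1,\gamma_2,\gamma_3,\gamma_4):W\to T_{\mathrm{RL}}W$. A valuation assigns an up-set of $W$ to each $p\in V$. Interpretation $[\![\cdot]\!]\subseteq W$: - Variables by the valuation; $\wedge,\vee,\top,\bot,\neg$ as intersection, union, $W$, $\emptyset$, complement. - $w\in[\![I]\!]$ iff $\gamma_1(w)=0$. - $w\in[\![a\otimes b]\!]$ iff there is $(x,y)\in\gamma_2(w)$ with $x\in[\![a]\!]$ and $y\in[\![b]\!]$. - $w\in[\![a\backslash c]\!]$ iff for all $(x,y)\in\gamma_3(w)$, $x\in[\![a]\!]$ implies $y\in[\![c]\!]$. - $w\in[\![c/b]\!]$ iff for all $(x,y)\in\gamma_4(w)$, $y\in[\![b]\!]$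 implies $x\in[\![c]\!]$. A coalgebra validates FC1–FC6 if, for every valuation, each axiom (with $a,b,c$ read as variables) holds with $=$ and $\le$ interpreted as equality and inclusion of interpretations. *)

(* Defs.v *)
From HB Require Import structures.
From mathcomp Require Import all_boot all_order.
From mathcomp Require Import boolp classical_sets.

Set Implicit Arguments.
Unset Strict Implicit.
Unset Printing Implicit Defensive.
Import Order.TTheory.
Local Open Scope order_scope.
Local Open Scope classical_set_scope.
Local Open Scope quotient_scope.

Variant base := DL | BDL | BA.

Definition bounded (C : base) : bool := if C is DL then false else true.
Definition boolean (C : base) : bool := if C is BA then true else false.

(* Algebras in the signature of the base category C together with
   I, tensor, \ and /.  Top and bottom exist only when C is bounded, and
   negation only when C is BA; no equation is imposed at this point. *)
Record alg (C : base) := Alg {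
  car :> Type;
  meet : car -> car -> car;
  join : car -> car -> car;
  top : bounded C -> car;
  bot : bounded C -> car;
  neg : boolean C -> car -> car;
  one : car;
  tens : car -> car -> car;
  under : car -> car -> car;  (* under a c is a \ c *)
  over : car -> car -> car    (* over c b is c / b *)
}.
Arguments top {C} a _.
Arguments bot {C} a _.
Arguments one {C} a.

Definition le_alg (C : base) (A : alg C) (s t : A) : Prop := meet s t = s.

Record is_object (C : base) (A : alg C) : Prop := IsObject {
  obj_meetA : forall x y z : A, meet x (meet y z) = meet (meet x y) z;
  obj_joinA : forall x y z : A, join x (join y z) = join (join x y) z;
  obj_meetC : forall x y : A, meet x y = meet y x;
  obj_joinC : forall x y : A, join x y = join y x;
  obj_meetK : forall x y : A, meet x (join x y) = x;
  obj_joinK : forall x y : A, join x (meet x y) = x;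
  obj_meetDjoin : forall x y z : A,
    meet x (join y z) = join (meet x y) (meet x z);
  obj_meet_top : forall (b : bounded C) (x : A), meet x (top A b) = x;
  obj_join_bot : forall (b : bounded C) (x : A), join x (bot A b) = x;
  obj_meet_neg : forall (b : bounded C) (n : boolean C) (x : A),
    meet x (neg n x) = bot A b;
  obj_join_neg : forall (b : bounded C) (n : boolean C) (x : A),
    join x (neg n x) = top A b
}.

(* Finite sets are represented by sequences.  A sequence is admissible when it
   is nonempty or C has bounds; only those have a meet and a join. *)
Definition admissible (C : base) (T : Type) (X : seq T) : Prop :=
  nilp X -> bounded C.

Lemma admissible_map (C : base) (T U : Type) (f : T -> U) (X : seq T) :
  admissible C X -> admissible C (map f X).
Proof. by case: X. Qed.
Arguments admissible_map {C T U} f {X} h.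

Definition bigmeet (C : base) (A : alg C) (X : seq A) :
    admissible C X -> A :=
  match X return admissible C X -> A with
  | [::] => fun h => top A (h isT)
  | x :: X' => fun _ => foldr (@meet C A) x X'
  end.

Arguments bigmeet {C A X} h.

Definition bigjoin (C : base) (A : alg C) (X : seq A) :
    admissible C X -> A :=
  match X return admissible C X -> A with
  | [::] => fun h => bot A (h isT)
  | x :: X' => fun _ => foldr (@join C A) x X'
  end.

Arguments bigjoin {C A X} h.

Record is_LRL (C : base) (A : alg C) : Prop := IsLRL {
  LRL_object : is_object A;
  tens_joinl : forall (X : seq A) (h : admissible C X) (a : A),
    tens (bigjoin h) a
    = bigjoin (admissible_map (fun x => tens x a) h);
  tens_joinr : forall (X : seq A) (h : admissible C X) (a : A),
    tens a (bigjoin h)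
    = bigjoin (admissible_map (fun x => tens a x) h);
  under_meet : forall (X : seq A) (h : admissible C X) (a : A),
    under a (bigmeet h)
    = bigmeet (admissible_map (fun x => under a x) h);
  under_join : forall (X : seq A) (h : admissible C X) (a : A),
    under (bigjoin h) a
    = bigmeet (admissible_map (fun x => under x a) h);
  over_meet : forall (X : seq A) (h : admissible C X) (a : A),
    over (bigmeet h) a
    = bigmeet (admissible_map (fun x => over x a) h);
  over_join : forall (X : seq A) (h : admissible C X) (a : A),
    over a (bigjoin h)
    = bigmeet (admissible_map (fun x => over a x) h)
}.

Record is_hom (C : base) (A B : alg C) (h : A -> B) : Prop := IsHom {
  hom_meet : forall x y : A, h (meet x y) = meet (h x) (h y);
  hom_join : forall x y : A, h (join x y) = join (h x) (h y);
  hom_top : forall b : bounded C, h (top A b) = top B b;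
  hom_bot : forall b : bounded C, h (bot A b) = bot B b;
  hom_neg : forall (n : boolean C) (x : A), h (neg n x) = neg n (h x);
  hom_one : h (one A) = one B;
  hom_tens : forall x y : A, h (tens x y) = tens (h x) (h y);
  hom_under : forall x y : A, h (under x y) = under (h x) (h y);
  hom_over : forall x y : A, h (over x y) = over (h x) (h y)
}.

Record congruence (C : base) (A : alg C) := Congruence {
  cong_rel :> A -> A -> Prop;
  cong_refl : forall x : A, cong_rel x x;
  cong_sym : forall x y : A, cong_rel x y -> cong_rel y x;
  cong_trans : forall y x z : A,
    cong_rel x y -> cong_rel y z -> cong_rel x z;
  cong_meet : forall x x' y y' : A,
    cong_rel x x' -> cong_rel y y' -> cong_rel (meet x y) (meet x' y');
  cong_join : forall x x' y y' : A,
    cong_rel x x' -> cong_rel y y' -> cong_rel (join x y) (join x' y');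
  cong_neg : forall (n : boolean C) (x x' : A),
    cong_rel x x' -> cong_rel (neg n x) (neg n x');
  cong_tens : forall x x' y y' : A,
    cong_rel x x' -> cong_rel y y' -> cong_rel (tens x y) (tens x' y');
  cong_under : forall x x' y y' : A,
    cong_rel x x' -> cong_rel y y' -> cong_rel (under x y) (under x' y');
  cong_over : forall x x' y y' : A,
    cong_rel x x' -> cong_rel y y' -> cong_rel (over x y) (over x' y')
}.

(* The intersection of all congruences satisfying P. *)
Definition gen_rel (C : base) (A : alg C) (P : congruence A -> Prop)
  (x y : A) : Prop := forall R : congruence A, P R -> R x y.

Definition gen_cong (C : base) (A : alg C) (P : congruence A -> Prop) :
  congruence A.
Proof.
exists (gen_rel P).
- by move=> x R _; exact: cong_refl.
- by move=> x y H R PR; apply: cong_sym; exact: H.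
- by move=> y x z H K R PR; apply: (@cong_trans _ _ R y); [exact: H|exact: K].
- by move=> x x' y y' H K R PR; apply: cong_meet; [exact: H|exact: K].
- by move=> x x' y y' H K R PR; apply: cong_join; [exact: H|exact: K].
- by move=> n x x' H R PR; apply: cong_neg; exact: H.
- by move=> x x' y y' H K R PR; apply: cong_tens; [exact: H|exact: K].
- by move=> x x' y y' H K R PR; apply: cong_under; [exact: H|exact: K].
- by move=> x x' y y' H K R PR; apply: cong_over; [exact: H|exact: K].
Defined.

Definition cong_bool (C : base) (A : alg C) (R : congruence A) :
  rel {classic A} := fun x y => `[< R x y >].

Lemma cong_bool_refl (C : base) (A : alg C) (R : congruence A) :
  reflexive (cong_bool R).
Proof. by move=> x; apply/asboolP; exact: cong_refl. Qed.

Lemma cong_bool_sym (C : base) (A : alg C) (R : congruence A) :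
  symmetric (cong_bool R).
Proof.
by move=> x y; apply/idP/idP => /asboolP H; apply/asboolP; exact: cong_sym.
Qed.

Lemma cong_bool_trans (C : base) (A : alg C) (R : congruence A) :
  transitive (cong_bool R).
Proof.
move=> y x z /asboolP H /asboolP K; apply/asboolP.
exact: (@cong_trans _ _ R y).
Qed.

Definition cong_equiv (C : base) (A : alg C) (R : congruence A) :
    equiv_rel {classic A} :=
  EquivRel (cong_bool R) (@cong_bool_refl C A R) (@cong_bool_sym C A R)
    (@cong_bool_trans C A R).

Definition quot_car (C : base) (A : alg C) (R : congruence A) : Type :=
  {eq_quot (cong_equiv R)}.

Definition cls (C : base) (A : alg C) (R : congruence A) (x : A) :
  quot_car R := \pi_({eq_quot (cong_equiv R)}) (x : {classic A}).

Definition rep (C : base) (A : alg C) (R : congruence A) (q : quot_car R) :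
  A := repr (q : {eq_quot (cong_equiv R)}).

Definition quot (C : base) (A : alg C) (R : congruence A) : alg C :=
  @Alg C (quot_car R)
    (fun p q => cls R (meet (rep p) (rep q)))
    (fun p q => cls R (join (rep p) (rep q)))
    (fun b => cls R (top A b))
    (fun b => cls R (bot A b))
    (fun n p => cls R (neg n (rep p)))
    (cls R (one A))
    (fun p q => cls R (tens (rep p) (rep q)))
    (fun p q => cls R (under (rep p) (rep q)))
    (fun p q => cls R (over (rep p) (rep q))).

Definition proj (C : base) (A : alg C) (R : congruence A) (x : A) : quot R :=
  cls R x.

Lemma repK (C : base) (A : alg C) (R : congruence A) (q : quot R) :
  proj R (rep q) = q.
Proof. exact: reprK. Qed.

Lemma projP (C : base) (A : alg C) (R : congruence A) (x y : A) :
  proj R x = proj R y <-> R x y.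
Proof.
split.
  by move=> /(@eqmodP {classic A} (cong_equiv R)) /asboolP.
by move=> H; apply/(@eqmodP {classic A} (cong_equiv R)); apply/asboolP.
Qed.

Lemma proj_hom (C : base) (A : alg C) (R : congruence A) : is_hom (proj R).
Proof.
have E (x : A) : R x (rep (proj R x)) by apply/projP; rewrite repK.
by split=> //= *; apply/projP; by [apply: cong_meet|apply: cong_join
  |apply: cong_neg|apply: cong_tens|apply: cong_under|apply: cong_over].
Qed.

Inductive form (C : base) (V : Type) : Type :=
| Var of V
| And of form C V & form C V
| Or of form C V & form C V
| Top of bounded C
| Bot of bounded C
| Neg of boolean C & form C V
| One
| Tens of form C V & form C V
| Under of form C V & form C V
| Over of form C V & form C V.
Arguments Var {C V}.
Arguments Top {C V}.
Arguments Bot {C V}.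
Arguments One {C V}.

Definition form_alg (C : base) (V : Type) : alg C :=
  @Alg C (form C V) (@And C V) (@Or C V) Top Bot (@Neg C V) One
    (@Tens C V) (@Under C V) (@Over C V).

Fixpoint eval (C : base) (V : Type) (A : alg C) (e : V -> A)
    (s : form C V) : A :=
  match s with
  | Var p => e p
  | And s t => meet (eval e s) (eval e t)
  | Or s t => join (eval e s) (eval e t)
  | Top b => top A b
  | Bot b => bot A b
  | Neg n s => neg n (eval e s)
  | One => one A
  | Tens s t => tens (eval e s) (eval e t)
  | Under s t => under (eval e s) (eval e t)
  | Over s t => over (eval e s) (eval e t)
  end.

(* The free L_RL-algebra on the set V: formulas modulo the least congruence
   whose quotient is an L_RL-algebra.  Left adjoints compose, so this is also
   the free L_RL-algebra over the free C-object on V. *)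
Definition LRL_cong (C : base) (V : Type) : congruence (form_alg C V) :=
  gen_cong (fun R : congruence (form_alg C V) => is_LRL (quot R)).

Definition free_LRL (C : base) (V : Type) : alg C := quot (LRL_cong C V).

Lemma hom_bigmeet (C : base) (A B : alg C) (f : A -> B) (X : seq A)
    (h : admissible C X) :
  is_hom f -> f (bigmeet h) = bigmeet (admissible_map f h).
Proof.
move=> Hf; case: X h => [|x X] h /=.
  by rewrite (hom_top Hf); congr top; exact: bool_irrelevance.
by elim: X {h} => //= y X <-; rewrite (hom_meet Hf).
Qed.

Lemma hom_bigjoin (C : base) (A B : alg C) (f : A -> B) (X : seq A)
    (h : admissible C X) :
  is_hom f -> f (bigjoin h) = bigjoin (admissible_map f h).
Proof.
move=> Hf; case: X h => [|x X] h /=.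
  by rewrite (hom_bot Hf); congr bot; exact: bool_irrelevance.
by elim: X {h} => //= y X <-; rewrite (hom_join Hf).
Qed.

Lemma bigmeet_eq (C : base) (A : alg C) (X Y : seq A)
    (h : admissible C X) (k : admissible C Y) :
  X = Y -> bigmeet h = bigmeet k.
Proof.
move=> E; case: Y / E k => k; case: X h k => //= h k.
by congr top; exact: bool_irrelevance.
Qed.

Lemma bigjoin_eq (C : base) (A : alg C) (X Y : seq A)
    (h : admissible C X) (k : admissible C Y) :
  X = Y -> bigjoin h = bigjoin k.
Proof.
move=> E; case: Y / E k => k; case: X h k => //= h k.
by congr bot; exact: bool_irrelevance.
Qed.

Lemma separated_LRL (C : base) (A : alg C) :
  (forall x y : A, (forall (B : alg C) (f : A -> B),
     is_LRL B -> is_hom f -> f x = f y) -> x = y) ->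
  is_LRL A.
Proof.
move=> S; split.
- split=> *; apply: S => B f BL Hf;
    rewrite !(hom_meet Hf, hom_join Hf, hom_neg Hf, hom_top Hf, hom_bot Hf);
    case: (LRL_object BL) => *; auto.
all: move=> X h a; apply: S => B f BL Hf.
all: rewrite ?(hom_tens Hf, hom_under Hf, hom_over Hf).
all: rewrite !(hom_bigmeet _ Hf, hom_bigjoin _ Hf).
all: rewrite ?(tens_joinl BL, tens_joinr BL, under_meet BL, under_join BL,
  over_meet BL, over_join BL).
all: try apply: bigjoin_eq; try apply: bigmeet_eq.
all: rewrite -!map_comp; apply: eq_map => x /=.
all: by rewrite ?(hom_tens Hf, hom_under Hf, hom_over Hf).
Qed.

Lemma eval_hom (C : base) (V : Type) (A : alg C) (e : V -> A) :
  is_hom (eval e : form_alg C V -> A).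
Proof. by split. Qed.

Lemma quot_lift_hom (C : base) (A B : alg C) (R : congruence A)
    (f : A -> B) :
  is_hom f -> (forall x y : A, R x y -> f x = f y) ->
  is_hom (fun q : quot R => f (rep q)).
Proof.
move=> Hf K; have E (x : A) : f (rep (proj R x)) = f x.
  by apply: K; apply/projP; rewrite repK.
by split=> *; rewrite /= E ?(hom_meet Hf, hom_join Hf, hom_top Hf, hom_bot Hf,
  hom_neg Hf, hom_one Hf, hom_tens Hf, hom_under Hf, hom_over Hf).
Qed.

Definition ker (C : base) (A B : alg C) (f : A -> B) (Hf : is_hom f) :
  congruence A.
Proof.
exists (fun x y => f x = f y); do ?[by []].
- by move=> y x z -> ->.
- by move=> x x' y y' E F; rewrite !(hom_meet Hf) E F.
- by move=> x x' y y' E F; rewrite !(hom_join Hf) E F.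
- by move=> n x x' E; rewrite !(hom_neg Hf) E.
- by move=> x x' y y' E F; rewrite !(hom_tens Hf) E F.
- by move=> x x' y y' E F; rewrite !(hom_under Hf) E F.
- by move=> x x' y y' E F; rewrite !(hom_over Hf) E F.
Defined.

Lemma free_LRL_is_LRL (C : base) (V : Type) : is_LRL (free_LRL C V).
Proof.
apply: separated_LRL => x y; rewrite -(repK x) -(repK y) => S.
apply/projP => R RL.
have L := @quot_lift_hom C _ _ (LRL_cong C V) (proj R) (proj_hom R).
have K (s t : form_alg C V) : LRL_cong C V s t -> proj R s = proj R t.
  by move=> H; apply/projP; exact: H.
have E s : proj R (rep (proj (LRL_cong C V) s)) = proj R s.
  by apply: K; apply/projP; rewrite repK.
by apply/projP; move: (S _ _ RL (L K)); rewrite !E.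
Qed.

Lemma free_LRL_universal (C : base) (V : Type) (A : alg C) (e : V -> A) :
  is_LRL A ->
  exists! f : free_LRL C V -> A,
    is_hom f /\ forall p : V, f (proj (LRL_cong C V) (Var p)) = e p.
Proof.
move=> AL; pose ev : form_alg C V -> A := eval e.
have L : is_LRL (quot (ker (eval_hom e))).
  apply: separated_LRL => x y S; rewrite -(repK x) -(repK y).
  apply/projP; apply: (S A (fun q => ev (rep q)) AL).
  exact: quot_lift_hom (eval_hom e) _.
have K (s t : form_alg C V) : LRL_cong C V s t -> ev s = ev t.
  by move=> /(_ (ker (eval_hom e)) L).
have Hf : is_hom (fun q : free_LRL C V => ev (rep q)).
  exact: quot_lift_hom (eval_hom e) K.
have E s : ev (rep (proj (LRL_cong C V) s)) = ev s.
  by apply: K; apply/projP; rewrite repK.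
exists (fun q => ev (rep q)); split; first by split=> // p; exact: E.
move=> f [Gf fe]; apply/funext => q; rewrite -(repK q) E.
have Hp := proj_hom (LRL_cong C V).
elim: (rep q) => /=.
- by move=> p; rewrite fe.
- by move=> a IHa b IHb; rewrite (hom_meet Hp) (hom_meet Gf) -IHa -IHb.
- by move=> a IHa b IHb; rewrite (hom_join Hp) (hom_join Gf) -IHa -IHb.
- by move=> b; rewrite (hom_top Hp) (hom_top Gf).
- by move=> b; rewrite (hom_bot Hp) (hom_bot Gf).
- by move=> n a IHa; rewrite (hom_neg Hp) (hom_neg Gf) -IHa.
- by rewrite (hom_one Hp) (hom_one Gf).
- by move=> a IHa b IHb; rewrite (hom_tens Hp) (hom_tens Gf) -IHa -IHb.
- by move=> a IHa b IHb; rewrite (hom_under Hp) (hom_under Gf) -IHa -IHb.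
- by move=> a IHa b IHb; rewrite (hom_over Hp) (hom_over Gf) -IHa -IHb.
Qed.

Variant axvar := va | vb | vc.

Variant axiom (C : base) : Type :=
| Eqn of form C axvar & form C axvar
| Ineqn of form C axvar & form C axvar.

Variant FC (C : base) : axiom C -> Prop :=
| FC1r : FC (Eqn (Tens (Var va) One) (Var va))
| FC1l : FC (Eqn (Tens One (Var va)) (Var va))
| FC2u : FC (Ineqn One (Under (Var va) (Var va)))
| FC2o : FC (Ineqn One (Over (Var va) (Var va)))
| FC3 : FC (Ineqn (Tens (Var va) (Under (Var vb) (Var vc)))
                  (Under (Tens (Var va) (Var vb)) (Var vc)))
| FC4 : FC (Ineqn (Tens (Over (Var vc) (Var vb)) (Var va))
                  (Over (Var vc) (Tens (Var va) (Var vb))))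
| FC5 : FC (Ineqn (Tens (Over (Var va) (Var vb)) (Var vb)) (Var va))
| FC6 : FC (Ineqn (Tens (Var vb) (Under (Var vb) (Var va))) (Var va)).

Definition contains_axiom (C : base) (A : alg C) (R : congruence A)
    (ax : axiom C) : Prop :=
  match ax with
  | Eqn s t => forall e : axvar -> A, R (eval e s) (eval e t)
  | Ineqn s t => forall e : axvar -> A,
      R (meet (eval e s) (eval e t)) (eval e s)
  end.

Definition fully_invariant (C : base) (A : alg C) (R : congruence A) : Prop :=
  forall h : A -> A, is_hom h -> forall x y : A, R x y -> R (h x) (h y).

(* The axiom letters a, b, c range over all of the free algebra, so that the
   definition makes sense even if V has fewer than three elements. *)
Definition FC_cong (C : base) (V : Type) : congruence (free_LRL C V) :=
  gen_cong (fun R : congruence (free_LRL C V) =>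
    fully_invariant R /\ forall ax : axiom C, FC ax -> contains_axiom R ax).

Definition L_FC (C : base) (V : Type) : alg C := quot (FC_cong C V).

Definition class_FC (C : base) (V : Type) (s : form C V) : L_FC C V :=
  proj (FC_cong C V) (proj (LRL_cong C V) (s : form_alg C V)).

Definition form_bigmeet (C : base) (V : Type) (X : seq (form C V))
  (h : admissible C X) : form C V := bigmeet (h : @admissible C (form_alg C V) X).
Definition form_bigjoin (C : base) (V : Type) (X : seq (form C V))
  (h : admissible C X) : form C V := bigjoin (h : @admissible C (form_alg C V) X).

Definition convex (d : Order.disp_t) (T : porderType d) (U : set T) : Prop :=
  forall x y z : T, U x -> U z -> x <= y -> y <= z -> U y.

Definition Pc (d : Order.disp_t) (T : porderType d) : Type :=
  {U : set T | convex U}.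

Definition le_EM (d : Order.disp_t) (T : porderType d) (U U' : Pc T) : Prop :=
  (forall u, sval U u -> exists2 u', sval U' u' & u <= u') /\
  (forall u', sval U' u' -> exists2 u, sval U u & u <= u').

(* The poset 2 ordered by 1 <= 0 is bool^d, with false for 0 and true for 1. *)
Record TRL (d : Order.disp_t) (W : porderType d) : Type := MkTRL {
  trl1 : bool^d;
  trl2 : Pc (W *p W)%type;
  trl3 : Pc (W^d *p W)%type;
  trl4 : Pc (W *p W^d)%type
}.

Definition le_TRL (d : Order.disp_t) (W : porderType d) (t t' : TRL W) :
    Prop :=
  [/\ trl1 t <= trl1 t', le_EM (trl2 t) (trl2 t'),
      le_EM (trl3 t) (trl3 t') & le_EM (trl4 t) (trl4 t')].

Definition is_coalgebra (d : Order.disp_t) (W : porderType d)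
    (g : W -> TRL W) : Prop :=
  forall w w' : W, w <= w' -> le_TRL (g w) (g w').

Definition discrete_order (d : Order.disp_t) (W : porderType d) : Prop :=
  forall x y : W, x <= y -> x = y.

Definition is_valuation (V : Type) (d : Order.disp_t) (W : porderType d)
    (v : V -> set W) : Prop :=
  forall (p : V) (x y : W), x <= y -> v p x -> v p y.

Fixpoint interp (C : base) (V : Type) (d : Order.disp_t) (W : porderType d)
    (g : W -> TRL W) (v : V -> set W) (s : form C V) : set W :=
  match s with
  | Var p => v p
  | And a b => interp g v a `&` interp g v b
  | Or a b => interp g v a `|` interp g v b
  | Top _ => setT
  | Bot _ => set0
  | Neg _ a => ~` interp g v a
  | One => [set w | trl1 (g w) = false]
  | Tens a b => [set w | exists x y : W,
      [/\ sval (trl2 (g w)) (x, y), interp g v a x & interp g v b y]]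
  | Under a c => [set w | forall x y : W,
      sval (trl3 (g w)) (x, y) -> interp g v a x -> interp g v c y]
  | Over c b => [set w | forall x y : W,
      sval (trl4 (g w)) (x, y) -> interp g v b y -> interp g v c x]
  end.

Definition valid_axiom (C : base) (d : Order.disp_t) (W : porderType d)
    (g : W -> TRL W) (ax : axiom C) : Prop :=
  forall v : axvar -> set W, is_valuation v ->
  match ax with
  | Eqn s t => interp g v s = interp g v t
  | Ineqn s t => interp g v s `<=` interp g v t
  end.

Definition validates_FC (C : base) (d : Order.disp_t) (W : porderType d)
    (g : W -> TRL W) : Prop :=
  forall ax : axiom C, FC ax -> valid_axiom g ax.

(* Main.v *)
(* In every algebra satisfying FC1-FC6, FC2, FC3, FC6 give [a (x) a <= I], hence
   [I] is the greatest element and [a (x) b <= a /\ b].  So in a frame all that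
   FC1-FC6 require is that the tensor relation stays below the current point
   and reaches it in either component, that the pairs of the two implication
   relations are increasing, and the two instances of residuation FC5 and FC6.
   Such a frame is obtained from the prime filters of L_FC, on which the truth
   lemma holds as usual; the Egli-Milner monotonicity, which the bare canonical
   relations violate, is restored by adjoining a least and a greatest point.  By
   persistence the truth lemma is not needed at these two points. *)
Require Import Defs.
From HB Require Import structures.
From mathcomp Require Import all_boot all_order.
From mathcomp Require Import boolp classical_sets.
From Stdlib Require List.
Import Order.POrderTheory.
Local Open Scope classical_set_scope.

Set Implicit Arguments.
Unset Strict Implicit.
Unset Printing Implicit Defensive.

(** * The lattice order on an object of the base category *)

Section LatticeOrder.
Variables (C : base) (A : alg C) (O : is_object A).
Implicit Types x y z : A.

Lemma alg_lexx x : le_alg x x.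
Proof. by have := obj_meetK O x (meet x x); rewrite (obj_joinK O). Qed.

Lemma alg_le_trans y x z : le_alg x y -> le_alg y z -> le_alg x z.
Proof. by rewrite /le_alg => xy yz; rewrite -{1}xy -(obj_meetA O) yz xy. Qed.

Lemma alg_le_anti x y : le_alg x y -> le_alg y x -> x = y.
Proof. by move=> xy yx; rewrite -[LHS]xy (obj_meetC O) yx. Qed.

Lemma alg_leIl x y : le_alg (meet x y) x.
Proof. by rewrite /le_alg (obj_meetC O) (obj_meetA O) alg_lexx. Qed.

Lemma alg_leIr x y : le_alg (meet x y) y.
Proof. by rewrite (obj_meetC O); exact: alg_leIl. Qed.

Lemma alg_lexI x y z : le_alg z x -> le_alg z y -> le_alg z (meet x y).
Proof. by rewrite /le_alg (obj_meetA O) => ->. Qed.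

Lemma alg_leUl x y : le_alg x (join x y).
Proof. exact: obj_meetK O x y. Qed.

Lemma alg_leUr x y : le_alg y (join x y).
Proof. by rewrite (obj_joinC O); exact: alg_leUl. Qed.

Lemma alg_leUx x y z : le_alg x z -> le_alg y z -> le_alg (join x y) z.
Proof.
rewrite /le_alg => xz yz.
by rewrite (obj_meetC O) (obj_meetDjoin O) !(obj_meetC O z) xz yz.
Qed.

Lemma alg_le0x (b : bounded C) x : le_alg (bot A b) x.
Proof.
by have := alg_leUl (bot A b) x; rewrite (obj_joinC O) (obj_join_bot O).
Qed.

Lemma alg_lex1 (b : bounded C) x : le_alg x (top A b).
Proof. exact: obj_meet_top. Qed.

Lemma alg_joinE x y : le_alg x y -> y = join x y.
Proof.
move=> xy; apply: alg_le_anti; first exact: alg_leUr.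
exact: alg_leUx xy (alg_lexx y).
Qed.

End LatticeOrder.

Definition satisfies (C : base) (A : alg C) (ax : Defs.axiom C) : Prop :=
  forall e : axvar -> A,
  match ax with
  | Eqn s t => eval e s = eval e t
  | Ineqn s t => le_alg (eval e s) (eval e t)
  end.

(** * Transfer of the laws and axioms to quotients *)

Section QuotientLRL.
Variables (C : base) (A : alg C) (R : congruence A).

(** The laws are equations and [proj R] is a surjective homomorphism, so elements, and sequences
    entrywise, can be replaced by images of representatives. *)
Lemma quot_LRL : is_LRL A -> is_LRL (quot R).
Proof.
move=> AL; have Hp := proj_hom R.
have repS (X : seq (quot R)) : X = map (proj R) (map (@rep C A R) X).
  by rewrite -map_comp -[LHS]map_id; apply: eq_map => x /=; rewrite repK.
split.
- case: (LRL_object AL) => *; split=> *;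
  repeat match goal with q : car (quot R) |- _ =>
    rewrite -(repK q); move: (rep q) => {q} ? end;
  rewrite -?(hom_neg Hp, hom_top Hp, hom_bot Hp) -?(hom_meet Hp, hom_join Hp);
  congr (proj R _); auto.
all: move=> X h a; have h' : admissible C (map (@rep C A R) X)
  by exact: admissible_map.
all: rewrite -(repK a) ?(bigjoin_eq h (admissible_map (proj R) h') (repS X)).
all: rewrite ?(bigmeet_eq h (admissible_map (proj R) h') (repS X)).
all: rewrite -?(hom_bigmeet _ Hp, hom_bigjoin _ Hp).
all: rewrite -?(hom_tens Hp, hom_under Hp, hom_over Hp).
all: rewrite ?(tens_joinl AL, tens_joinr AL, under_meet AL, under_join AL,
  over_meet AL, over_join AL) (hom_bigmeet _ Hp, hom_bigjoin _ Hp).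
all: try apply: bigjoin_eq; try apply: bigmeet_eq.
all: rewrite -!map_comp; apply: eq_map => x; rewrite [LHS]/=.
all: by rewrite (hom_tens Hp, hom_under Hp, hom_over Hp) !repK.
Qed.

Lemma quot_satisfies (ax : Defs.axiom C) :
  contains_axiom R ax -> satisfies (quot R) ax.
Proof.
have evE (e : axvar -> quot R) s :
    eval e s = proj R (eval (fun p => rep (e p)) s).
  have Hp := proj_hom R.
  elim: s => [p|s /= -> t ->|s /= -> t ->|b|b|n s /= ->||s /= -> t ->
    |s /= -> t ->|s /= -> t ->] /=; by rewrite ?repK ?(hom_meet Hp, hom_join Hp,
    hom_top Hp, hom_bot Hp, hom_neg Hp, hom_one Hp, hom_tens Hp, hom_under Hp,
    hom_over Hp).
case: ax => s t H e; rewrite ?/le_alg !evE -?(hom_meet (proj_hom R));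
  apply/projP; exact: H.
Qed.

End QuotientLRL.

Record is_FC_algebra (C : base) (A : alg C) : Prop := IsFC {
  FC_LRL : is_LRL A;
  FC_satisfies : forall ax, FC ax -> satisfies A ax
}.

Lemma L_FC_is_FC_algebra (C : base) (V : Type) : is_FC_algebra (L_FC C V).
Proof.
split; first exact/quot_LRL/free_LRL_is_LRL.
move=> ax FCax; apply: quot_satisfies.
by case: ax FCax => s t FCax e R [_ RFC]; have := RFC _ FCax; exact.
Qed.

(** * Integrality and residuation in algebras satisfying FC1-FC6 *)

Section FCAlgebra.
Variables (C : base) (A : alg C) (AF : is_FC_algebra A).
Implicit Types a b c d : A.

Let L := FC_LRL AF.
Let O := LRL_object L.
Local Notation I := (Defs.one A).

Let adm2 a b : admissible C [:: a; b]. Proof. by []. Qed.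
Let adm0 (h : bounded C) : admissible C (@nil A). Proof. by []. Qed.

Let val3 a b c (p : axvar) := match p with va => a | vb => b | vc => c end.

Lemma tensx1 a : tens a I = a.
Proof. exact (FC_satisfies AF (FC1r C) (val3 a a a)). Qed.

Lemma tens1x a : tens I a = a.
Proof. exact (FC_satisfies AF (FC1l C) (val3 a a a)). Qed.

Lemma le1_under a : le_alg I (under a a).
Proof. exact (FC_satisfies AF (FC2u C) (val3 a a a)). Qed.

Lemma le1_over a : le_alg I (Defs.over a a).
Proof. exact (FC_satisfies AF (FC2o C) (val3 a a a)). Qed.

Lemma tens_over_le a b : le_alg (tens (Defs.over a b) b) a.
Proof. exact (FC_satisfies AF (FC5 C) (val3 a b a)). Qed.

Lemma tens_under_le a b : le_alg (tens b (under b a)) a.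
Proof. exact (FC_satisfies AF (FC6 C) (val3 a b a)). Qed.

Lemma tensUl a b c : tens (join a b) c = join (tens a c) (tens b c).
(* [bigjoin] uses the head of the sequence as seed of the fold, so it is [[:: b; a]] that yields
   [join a b]. *)
Proof. by have /= := tens_joinl L (@adm2 b a) c. Qed.

Lemma tensUr a b c : tens c (join a b) = join (tens c a) (tens c b).
Proof. by have /= := tens_joinr L (@adm2 b a) c. Qed.

Lemma tens0x (h : bounded C) a : tens (bot A h) a = bot A h.
Proof.
rewrite (bool_irrelevance h (@adm0 h isT)) [LHS](tens_joinl L (@adm0 h)) /=.
congr bot; exact: bool_irrelevance.
Qed.

Lemma tensx0 (h : bounded C) a : tens a (bot A h) = bot A h.
Proof.
rewrite (bool_irrelevance h (@adm0 h isT)) [LHS](tens_joinr L (@adm0 h)) /=.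
congr bot; exact: bool_irrelevance.
Qed.

Lemma le_tens a b c d :
  le_alg a b -> le_alg c d -> le_alg (tens a c) (tens b d).
Proof.
move=> /(alg_joinE O) -> /(alg_joinE O) ->; rewrite tensUl !tensUr.
apply: (alg_le_trans O (alg_leUl O _ (tens a d))); exact: alg_leUl.
Qed.

(* Instantiating FC3 at a, I, I and combining it with FC6 squeezes [a (x) a]
   below I. *)
Lemma le_one a : le_alg a I.
Proof.
have sq b : le_alg (tens b b) I.
  have /= fc3 := FC_satisfies AF (FC3 C) (val3 b I I).
  rewrite tensx1 in fc3.
  apply: (alg_le_trans O _ (tens_under_le I b)).
  apply: (le_tens (alg_lexx O b)); apply: (alg_le_trans O _ fc3).
  by rewrite -{1}[b]tensx1; apply: (le_tens (alg_lexx O b)); exact: le1_under.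
(* The square of [join a I] dominates [tens a I], which is [a]. *)
apply: (alg_le_trans O _ (sq (join a I))).
by rewrite -{1}[a]tensx1; apply: le_tens; [exact: alg_leUl | exact: alg_leUr].
Qed.

(* Covers [\] as well as [/] with its arguments swapped. *)
Record is_implication (imp : A -> A -> A) : Prop := IsImplication {
  impI : forall a b c, imp a (meet b c) = meet (imp a b) (imp a c);
  impU : forall a b c, imp (join a b) c = meet (imp a c) (imp b c);
  imp0 : forall (h : bounded C) c, le_alg I (imp (bot A h) c);
  impxx : forall a, le_alg I (imp a a);
  imp1 : forall c, le_alg (imp I c) c
}.

Lemma under_implication : is_implication (@under C A).
Proof.
split=> [a b c|a b c|h c|a|c].
- by have /= := under_meet L (@adm2 c b) a.
- by have /= := under_join L (@adm2 b a) c.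
- rewrite (bool_irrelevance h (@adm0 h isT)).
  by rewrite [X in le_alg _ X](under_join L (@adm0 h)); exact: alg_lex1.
- exact: le1_under.
- by rewrite -[under _ _]tens1x; exact: tens_under_le.
Qed.

Lemma over_implication : is_implication (fun a c => Defs.over c a).
Proof.
split=> [a b c|a b c|h c|a|c].
- by have /= := over_meet L (@adm2 c b) a.
- by have /= := over_join L (@adm2 b a) c.
- rewrite (bool_irrelevance h (@adm0 h isT)).
  by rewrite [X in le_alg _ X](over_join L (@adm0 h)); exact: alg_lex1.
- exact: le1_over.
- by rewrite -[Defs.over _ _]tensx1; exact: tens_over_le.
Qed.

Lemma le_imp imp a b c d : is_implication imp ->
  le_alg b a -> le_alg c d -> le_alg (imp a c) (imp b d).
Proof.
move=> H ba cd.
rewrite (alg_joinE O ba) (impU H); apply: (alg_le_trans O (alg_leIl O _ _)).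
by rewrite -{1}cd (impI H); exact: alg_leIr.
Qed.

End FCAlgebra.

(** As [I] is the greatest element under FC1-FC6, [filter_one] amounts to nonemptiness and can be
    stated without bounds. *)
Record is_filter (C : base) (A : alg C) (F : set A) : Prop := IsFilter {
  filter_one : F (Defs.one A);
  filter_le : forall a b, le_alg a b -> F a -> F b;
  filter_meet : forall a b, F a -> F b -> F (meet a b)
}.

(* When C has no bounds, the whole algebra counts as a prime filter. *)
Record is_prime (C : base) (A : alg C) (F : set A) : Prop := IsPrime {
  prime_filter :> is_filter F;
  prime_join : forall a b, F (join a b) -> F a \/ F b;
  prime_bot : forall h : bounded C, ~ F (bot A h)
}.

Arguments prime_bot {C A F} _ h _.

Record pfilter (C : base) (A : alg C) : Type := PFilter {
  pset :> set A;
  pfilterP : is_prime pset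
}.

Lemma pfilter_inj (C : base) (A : alg C) (w w' : pfilter A) :
  (w : set A) = w' -> w = w'.
Proof.
case: w w' => [F Fp] [G Gp] /= E; case: G / E Gp => Gp.
by congr PFilter; exact: Prop_irrelevance.
Qed.

(** * Prime filters: extension, separation, and witnesses for the operations *)

Section Extension.
Variables (C : base) (A : alg C) (AF : is_FC_algebra A).
Implicit Types (a b c : A) (F G : set A).

Let O := LRL_object (FC_LRL AF).
Local Notation I := (Defs.one A).

Lemma up_filter a : is_filter [set x | le_alg a x].
Proof.
split=> [|x y xy ax|x y]; first exact: le_one.
- exact: alg_le_trans ax xy.
- exact: alg_lexI.
Qed.

(** Take [M] maximal among the filters above [F] and disjoint from [G]. If [join a b] were in [M]
    with [a] and [b] outside, distributivity would place the join of two members of [G] in [M]. *)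
Lemma prime_extension F G :
  is_filter F -> (forall x, F x -> ~ G x) ->
  (forall x y, G x -> G y -> G (join x y)) ->
  (forall h : bounded C, G (bot A h)) ->
  exists w : pfilter A, F `<=` w /\ forall x, (w : set A) x -> ~ G x.
Proof.
move=> Ff FG GU G0.
pose good X := [/\ is_filter X, F `<=` X & forall x, X x -> ~ G x].
(* Zorn's lemma also asks about the empty chain, whose union is [set0]; hence the first disjunct. It
   cannot hold for a maximal [M], as [F] is good and nonempty. *)
have [M [Mgood Mmax]] : exists M, (M = set0 \/ good M) /\
    forall B, M `<` B -> ~ (B = set0 \/ good B).
  apply: Zorn_bigcup => K Kgood Ktot.
  have [[X0 [KX0 gX0]]|none] := pselect (exists X, K X /\ good X); last first.
    left; apply/seteqP; split=> // x [X KX Xx].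
    have [X0|gX] := Kgood X KX; first by rewrite X0 in Xx.
    by case: none; exists X.
  have memgood X x : K X -> X x -> good X.
    by move=> KX Xx; have [X0'|//] := Kgood X KX; rewrite X0' in Xx.
  right; split.
  - split.
    + by exists X0 => //; case: gX0 => [[]].
    + move=> a b ab [X KX Xa]; exists X => //.
      by have [Xf _ _] := memgood X a KX Xa; exact: filter_le ab Xa.
    + move=> a b [X KX Xa] [Y KY Yb].
      have [Xf _ _] := memgood X a KX Xa; have [Yf _ _] := memgood Y b KY Yb.
      have [XY|YX] := Ktot X Y KX KY.
      * by exists Y => //; apply: (filter_meet Yf) => //; exact: XY.
      * by exists X => //; apply: (filter_meet Xf) => //; exact: YX.
  - by move=> x Fx; exists X0 => //; case: gX0 => _ + _; exact.
  - by move=> x [X KX Xx]; have [_ _] := memgood X x KX Xx; exact.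
have {Mgood} [Mf FM MG] : good M.
  case: Mgood => // M0; exfalso; apply: (Mmax F); last by right; split.
  by split=> [|FM]; [rewrite M0 | have := FM _ (filter_one Ff); rewrite M0].
have ext a : ~ M a -> exists2 m, M m & exists2 g, G g & le_alg (meet m a) g.
  move=> nMa; apply: contrapT => none.
  (* The filter generated by [M] and [a]; by maximality of [M] it must meet [G]. *)
  pose N : set A := [set x | exists2 m, M m & le_alg (meet m a) x].
  apply: (Mmax N).
    split=> [x Mx|NM]; first by exists x => //; exact: alg_leIl.
    apply: nMa; apply: NM; exists I; first exact: filter_one.
    exact: alg_leIr.
  right; split.
  - split.
    + by exists I; [exact: filter_one | exact: le_one].
    + by move=> x y xy [m Mm mx]; exists m => //; exact: alg_le_trans mx xy.
    + move=> x y [m Mm mx] [m' Mm' my]; exists (meet m m').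
        exact: filter_meet.
      apply: (alg_lexI O); [apply: (alg_le_trans O _ mx)
        |apply: (alg_le_trans O _ my)]; apply: (alg_lexI O).
      * apply: (alg_le_trans O (alg_leIl O _ _)); exact: alg_leIl.
      * exact: alg_leIr.
      * apply: (alg_le_trans O (alg_leIl O _ _)); exact: alg_leIr.
      * exact: alg_leIr.
  - by move=> x Fx; exists x; [exact: FM | exact: alg_leIl].
  - by move=> x [m Mm mx] Gx; apply: none; exists m => //; exists x.
have Mp : is_prime M.
  split=> // [a b Mab|h M0]; last exact: MG M0 (G0 h).
  apply: contrapT => /not_orP.
  move=> [/ext [m Mm [g Gg mg]] /ext [m' Mm' [g' Gg' mg']]].
  apply: (MG (join g g')); last exact: GU.
  apply: (filter_le Mf _ (filter_meet Mf (filter_meet Mf Mm Mm') Mab)).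
  rewrite (obj_meetDjoin O); apply: (alg_leUx O).
  - apply: (alg_le_trans O _ (alg_leUl O _ _)); apply: (alg_le_trans O _ mg).
    apply: (alg_lexI O); last exact: alg_leIr.
    apply: (alg_le_trans O (alg_leIl O _ _)); exact: alg_leIl.
  - apply: (alg_le_trans O _ (alg_leUr O _ _)); apply: (alg_le_trans O _ mg').
    apply: (alg_lexI O); last exact: alg_leIr.
    apply: (alg_le_trans O (alg_leIl O _ _)); exact: alg_leIr.
by exists (PFilter Mp).
Qed.

Lemma prime_separation a b :
  ~ le_alg a b -> exists w : pfilter A, (w : set A) a /\ ~ (w : set A) b.
Proof.
move=> nab; have [||||w [aw bw]] :=
    @prime_extension [set x | le_alg a x] [set x | le_alg x b].
- exact: up_filter.
- by move=> x /= ax xb; apply: nab; exact: alg_le_trans ax xb.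
- by move=> x y /=; exact: alg_leUx.
- by move=> h /=; exact: alg_le0x.
exists w; split; first by apply: aw => /=; exact: alg_lexx.
by move=> /bw; apply => /=; exact: alg_lexx.
Qed.

Lemma one_separation a : (forall w : pfilter A, (w : set A) a) -> a = I.
Proof.
move=> wa; apply: (alg_le_anti O (le_one AF a)); apply: contrapT.
by move=> /prime_separation [w [_]]; apply.
Qed.

(** Two successive extensions: [x] contains [a] and avoids the elements whose tensor with [b] is
    outside [w]; then [y] contains [b] and avoids those whose tensor with some member of [x] is
    outside [w]. The avoided sets are closed under joins since [tens] distributes over joins and [w]
    is prime. *)
Lemma prime_tens (w : pfilter A) a b : (w : set A) (tens a b) ->
  exists x y : pfilter A, [/\ (x : set A) a, (y : set A) b &
    forall c d, (x : set A) c -> (y : set A) d -> (w : set A) (tens c d)].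
Proof.
have wP := pfilterP w; move=> wab.
have [||||x [ax xG]] := @prime_extension [set x | le_alg a x]
    [set x | ~ (w : set A) (tens x b)].
- exact: up_filter.
- move=> x /= ax; apply; apply: (filter_le wP _ wab).
  by apply: le_tens => //; exact: alg_lexx.
- by move=> x y /= nx ny; rewrite tensUl // => /(prime_join wP) [].
- by move=> h /=; rewrite tens0x //; exact: prime_bot wP h.
have xP := pfilterP x.
have [||||y [by' yG]] := @prime_extension [set y | le_alg b y]
    [set y | exists2 c, (x : set A) c & ~ (w : set A) (tens c y)].
- exact: up_filter.
- move=> y /= by' [c xc]; apply; have /contrapT := xG c xc.
  by apply: (filter_le wP); apply: le_tens => //; exact: alg_lexx.
- move=> y y' /= [c xc ncy] [c' xc' ncy']; exists (meet c c').
    exact: (filter_meet xP).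
  rewrite tensUr // => /(prime_join wP) [] H; [apply: ncy | apply: ncy'];
    apply: (filter_le wP _ H); apply: le_tens => //;
    by [exact: alg_leIl | exact: alg_leIr | exact: alg_lexx].
- move=> h /=; exists I; first exact: (filter_one xP).
  by rewrite tensx0 //; exact: prime_bot wP h.
exists x, y; split.
- by apply: ax => /=; exact: alg_lexx.
- by apply: by' => /=; exact: alg_lexx.
- by move=> c d xc yd; apply: contrapT => nw; apply: (yG d yd); exists c.
Qed.

Section Implication.
Variables (imp : A -> A -> A) (impP : is_implication imp).

(** The consequent comes first: [y] extends the filter of all [d] with [imp a d] in [w] and avoids
    everything below [c]. Then [x] contains [a] and avoids every [b] with [imp b d] in [w] for some
    [d] outside [y]; primality of [y] closes this set under joins. *)
Lemma prime_imp (w : pfilter A) a c : ~ (w : set A) (imp a c) ->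
  exists x y : pfilter A, [/\ (x : set A) a, ~ (y : set A) c &
    forall b d, (w : set A) (imp b d) -> (x : set A) b -> (y : set A) d].
Proof.
have wP := pfilterP w; move=> nac.
have [||||y [yF yc]] := @prime_extension [set d | (w : set A) (imp a d)]
    [set d | le_alg d c].
- split=> [|d d' dd'|d d'] /=.
  + apply: (filter_le wP _ (filter_one wP)).
    apply: (alg_le_trans O (impxx impP a)); apply: (le_imp AF impP) => //.
      exact: alg_lexx.
    exact: le_one.
  + by apply: (filter_le wP); apply: (le_imp AF impP) => //; exact: alg_lexx.
  + by rewrite (impI impP); exact: (filter_meet wP).
- move=> d /= wad dc; apply: nac; apply: (filter_le wP _ wad).
  by apply: (le_imp AF impP) => //; exact: alg_lexx.
- by move=> d d' /=; exact: alg_leUx.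
- by move=> h /=; exact: alg_le0x.
have yP := pfilterP y.
have [||||x [ax xG]] := @prime_extension [set x | le_alg a x]
    [set b | exists2 d, ~ (y : set A) d & (w : set A) (imp b d)].
- exact: up_filter.
- move=> b /= ab [d nyd wbd]; apply: nyd; apply: yF => /=.
  apply: (filter_le wP _ wbd); apply: (le_imp AF impP) => //.
  exact: alg_lexx.
- move=> b b' /= [d nyd wbd] [d' nyd' wbd']; exists (join d d').
    by move=> /(prime_join yP) [].
  rewrite (impU impP); apply: (filter_meet wP).
  + by apply: (filter_le wP _ wbd); apply: (le_imp AF impP) => //;
      [exact: alg_lexx | exact: alg_leUl].
  + by apply: (filter_le wP _ wbd'); apply: (le_imp AF impP) => //;
      [exact: alg_lexx | exact: alg_leUr].
- move=> h; exists (bot A h); first exact: prime_bot yP h.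
  exact: (filter_le wP (imp0 impP h _) (filter_one wP)).
exists x, y; split.
- by apply: ax => /=; exact: alg_lexx.
- by move=> /yc; apply => /=; exact: alg_lexx.
- by move=> b d wbd xb; apply: contrapT => nyd; apply: (xG b xb); exists d.
Qed.

End Implication.

(** * The Boolean case: ultrafilters and idempotence of the tensor *)

Section Boolean.
Variable n : boolean C.

Let bnd : bounded C. Proof. by case: (C) n. Qed.

Lemma prime_neg (w : pfilter A) a :
  (w : set A) (neg n a) <-> ~ (w : set A) a.
Proof.
have wP := pfilterP w; split=> [wna wa|nwa].
  by apply: (prime_bot wP bnd); rewrite -(obj_meet_neg O bnd n a);
    exact: (filter_meet wP).
have : (w : set A) (join a (neg n a)).
  rewrite (obj_join_neg O bnd n); apply: (filter_le wP _ (filter_one wP)).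
  exact: alg_lex1.
by case/(prime_join wP).
Qed.

(** Prime filters are ultrafilters here; this makes the canonical order discrete for BA. *)
Lemma pfilter_max (w w' : pfilter A) : w `<=` w' -> w = w'.
Proof.
move=> ww'; apply/pfilter_inj/seteqP; split=> // a w'a.
by apply: contrapT => /prime_neg /ww' /prime_neg.
Qed.

(** With complements the tensor is the meet: [c] is [tens c (join c (neg n c))], and by integrality
    [tens c (neg n c)] lies below both [c] and its complement, so [c] is idempotent. *)
Lemma prime_tens_diag (w : pfilter A) a b :
  (w : set A) a -> (w : set A) b -> (w : set A) (tens a b).
Proof.
have wP := pfilterP w; move=> wa wb; set c := meet a b.
have wc : (w : set A) c by exact: (filter_meet wP).
have: (w : set A) (tens c (join c (neg n c))).
  rewrite (obj_join_neg O bnd n); apply: (filter_le wP _ wc).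
  rewrite -{1}(tensx1 AF c); apply: (le_tens AF (alg_lexx O c)).
  exact: alg_lex1.
rewrite tensUr // => /(prime_join wP) [] wcc.
  apply: (filter_le wP _ wcc).
  by apply: le_tens => //; [exact: alg_leIl | exact: alg_leIr].
case: (prime_bot wP bnd); rewrite -(obj_meet_neg O bnd n c).
apply: (filter_le wP _ wcc); apply: (alg_lexI O).
  by have := le_tens AF (alg_lexx O c) (le_one AF (neg n c)); rewrite tensx1.
by have := le_tens AF (le_one AF c) (alg_lexx O (neg n c)); rewrite tens1x.
Qed.

End Boolean.

End Extension.

(** The existential [Tens] uses the forward half of the Egli-Milner order, the universal [Under] and
    [Over] the backward half, with the order of the antecedent reversed. Negation is covered by
    discreteness. *)
Lemma interp_up (C : base) (V : Type) (d : Order.disp_t) (W : porderType d)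
    (g : W -> TRL W) (v : V -> set W) (s : form C V) :
  (boolean C -> discrete_order W) -> is_coalgebra g -> is_valuation v ->
  forall w w' : W, (w <= w')%O -> interp g v s w -> interp g v s w'.
Proof.
move=> disc gmono vup; elim: s => [p|a IHa b IHb|a IHa b IHb|b|b|n a IHa|
  |a IHa b IHb|a IHa c IHc|c IHc b IHb] w w' ww' /=.
- exact: vup ww'.
- by move=> [/(IHa _ _ ww') ? /(IHb _ _ ww')].
- by move=> [/(IHa _ _ ww')|/(IHb _ _ ww')]; [left|right].
- by [].
- by [].
- by rewrite (disc n _ _ ww').
- by have [+ _ _ _] := gmono _ _ ww'; move=> + w0; rewrite w0; case: (trl1 _).
- have [_ [+ _] _ _] := gmono _ _ ww'; move=> up [x [y [/up [[x' y'] xy']]]].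
  move=> /andP[/= xx' yy'] /(IHa _ _ xx') ax' /(IHb _ _ yy') by'.
  by exists x', y'.
- have [_ _ [_ up] _] := gmono _ _ ww'; move=> wac x' y' /up [[x y] xy].
  move=> /andP[/= xx' yy'] /(IHa _ _ xx') ax; apply: (IHc _ _ yy').
  exact: wac xy ax.
- have [_ _ _ [_ up]] := gmono _ _ ww'; move=> wcb x' y' /up [[x y] xy].
  move=> /andP[/= xx' yy'] /(IHb _ _ yy') bx; apply: (IHc _ _ xx').
  exact: wcb xy bx.
Qed.

(* The prime filters alone do not form a coalgebra: the Egli-Milner order
   demands that the three relations have enough pairs at every point.  An
   extra least and an extra greatest point supply them; they must be absent
   for BA, where the order is discrete. *)
Inductive cpoint (C : base) (A : alg C) : Type :=
| Pbot of ~~ boolean C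
| Pin of pfilter A
| Ptop of ~~ boolean C.
Arguments Pbot {C A}.
Arguments Ptop {C A}.

HB.instance Definition _ (C : base) (A : alg C) := gen_eqMixin (cpoint A).
HB.instance Definition _ (C : base) (A : alg C) := gen_choiceMixin (cpoint A).

Definition cpoint_le (C : base) (A : alg C) (x y : cpoint A) : bool :=
  match x, y with
  | Pbot _, _ => true
  | _, Ptop _ => true
  | Pin w, Pin w' => `[< w `<=` w' >]
  | _, _ => false
  end.

Lemma cpoint_le_refl (C : base) (A : alg C) : reflexive (@cpoint_le C A).
Proof. by case=> //= w; apply/asboolP. Qed.

Lemma cpoint_le_anti (C : base) (A : alg C) : antisymmetric (@cpoint_le C A).
Proof.
case=> [h|w|h] [h'|w'|h'] //=.
- by rewrite (bool_irrelevance h h').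
- move=> /andP[/asboolP ww' /asboolP w'w]; congr Pin.
  exact/pfilter_inj/seteqP.
- by rewrite (bool_irrelevance h h').
Qed.

Lemma cpoint_le_trans (C : base) (A : alg C) : transitive (@cpoint_le C A).
Proof.
case=> [h|w|h] [h'|w'|h'] [h''|w''|h''] //= /asboolP ww' /asboolP w'w''.
by apply/asboolP; apply: subset_trans w'w''.
Qed.

HB.instance Definition _ (C : base) (A : alg C) :=
  Order.Le_isPOrder.Build (Order.Disp tt tt) (cpoint A)
    (@cpoint_le_refl C A) (@cpoint_le_anti C A) (@cpoint_le_trans C A).

(** * The canonical coalgebra and the validity of FC1-FC6 *)

Section Canonical.
Variables (C : base) (A : alg C) (AF : is_FC_algebra A).
Implicit Types (a b c : A) (w : pfilter A) (x y z : cpoint A).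

Let O := LRL_object (FC_LRL AF).
Local Notation I := (Defs.one A).

(** [Pbot] is read as the least filter; since its only member is the unit of [tens], it can be
    paired with any prime filter in the tensor relation. *)
Definition elements x : set A :=
  match x with Pbot _ => [set I] | Pin w => w | Ptop _ => setT end.

Definition tens_in w x y : Prop :=
  [/\ (x <= Pin w)%O, (y <= Pin w)%O & forall a b,
     elements x a -> elements y b -> (w : set A) (tens a b)].

(** At [Ptop], the pairs of all prime filters serve monotonicity, while [(Ptop, Pbot)] and
    [(Pbot, Ptop)] serve FC1. The pair [(Ptop, Ptop)] is left out: FC5 and FC6 would fail on it. *)
Definition tens_rel z x y : Prop :=
  match z with
  | Pbot h => x = Pbot h /\ y = Pbot h
  | Pin w => tens_in w x y
  | Ptop h => [\/ x = Pbot h, y = Pbot h | exists w, tens_in w x y]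
  end.

(* Passing through a prime filter [w'] keeps [Ptop] out of the first component,
   which makes the value of [elements] at [Ptop] immaterial, and lets
   [(Pbot, Ptop)] in. *)
Definition arrow_rel (imp : A -> A -> A) z x y : Prop :=
  match z with
  | Pbot _ => (x <= y)%O
  | Pin w => exists w', [/\ (x <= Pin w')%O, (Pin w' <= y)%O & forall a c,
      (w : set A) (imp a c) -> elements x a -> (w' : set A) c]
  | Ptop h => x = Pbot h /\ y = Ptop h
  end.

Local Notation overC := (fun a c => Defs.over c a).

Lemma elements_le x y : (x <= y)%O -> elements x `<=` elements y.
Proof.
case: x y => [h|w|h] [h'|w'|h'] //= => [_ ? //|_ _ ->|/asboolP //].
exact: filter_one (pfilterP w').
Qed.

Lemma tens_in_down w x y x' y' : (x' <= x)%O -> (y' <= y)%O ->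
  tens_in w x y -> tens_in w x' y'.
Proof.
move=> xx' yy' [xw yw H]; split; [exact: le_trans xw|exact: le_trans yw|].
by move=> a b /(elements_le xx') xa /(elements_le yy'); exact: H.
Qed.

Lemma tens_rel_le z x y : tens_rel z x y -> (x <= z)%O /\ (y <= z)%O.
Proof.
by case: z => [h [-> ->]|w []|h] //; case: x y => [?|?|?] [?|?|?].
Qed.

Lemma tens_rel_down z x y x' y' : (x' <= x)%O -> (y' <= y)%O ->
  tens_rel z x y -> tens_rel z x' y'.
Proof.
have le_bot h t : (t <= Pbot h :> cpoint A)%O -> t = Pbot h.
  by case: t => // h' _; rewrite (bool_irrelevance h' h).
case: z => [h|w|h] xx' yy' /=.
- by move=> [E F]; move: xx' yy'; rewrite E F => /le_bot -> /le_bot ->.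
- exact: tens_in_down.
- case=> [E|E|[w H]].
  + by apply: Or31; apply: le_bot; rewrite -E.
  + by apply: Or32; apply: le_bot; rewrite -E.
  + by apply: Or33; exists w; exact: tens_in_down H.
Qed.

Lemma arrow_rel_up imp z x y x' y' : (x' <= x)%O -> (y <= y')%O ->
  arrow_rel imp z x y -> arrow_rel imp z x' y'.
Proof.
case: z => [h|w|h] xx' yy' /=.
- by move=> xy; exact: le_trans (le_trans xx' xy) yy'.
- move=> [w' [xw' w'y H]]; exists w'; split.
  + exact: le_trans xw'.
  + exact: le_trans yy'.
  + by move=> a c wac /(elements_le xx'); exact: H.
- move=> [E F]; move: xx' yy'; rewrite E F.
  case: x' => // h' _; case: y' => // h'' _.
  by rewrite (bool_irrelevance h' h) (bool_irrelevance h'' h).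
Qed.

Lemma arrow_rel_le imp z x y : arrow_rel imp z x y -> (x <= y)%O.
Proof.
case: z => [h|w [w' [xw' w'y _]]|h [-> ->]] //; exact: le_trans w'y.
Qed.

(** Convexity holds because each relation is closed in one direction: tensor pairs downwards,
    implication pairs upwards in the order with reversed antecedent. *)
Definition canon_tens z : Pc (cpoint A *p cpoint A)%type.
Proof.
exists [set u | tens_rel z u.1 u.2] => u u' u'' _ zu'' _ /andP[le1 le2].
exact: tens_rel_down zu''.
Defined.

Definition canon_under z : Pc ((cpoint A)^d *p cpoint A)%type.
Proof.
exists [set u | arrow_rel (@under C A) z u.1 u.2].
move=> u u' u'' zu _ /andP[le1 le2] _.
exact: arrow_rel_up zu.
Defined.

Definition canon_over z : Pc (cpoint A *p (cpoint A)^d)%type.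
Proof.
exists [set u | arrow_rel overC z u.2 u.1] => u u' u'' zu _ /andP[le1 le2] _.
exact: arrow_rel_up zu.
Defined.

(** The first component is constantly [0]: the greatest element [I] lies in every filter. *)
Definition canon_coalg z : TRL (cpoint A) :=
  MkTRL false (canon_tens z) (canon_under z) (canon_over z).

Lemma canon_discrete : boolean C -> discrete_order (cpoint A).
Proof.
move=> n; have nn (h : ~~ boolean C) : False by rewrite n in h.
case=> [/nn|w|/nn] // [/nn|w'|/nn] // /asboolP ww'.
by congr Pin; apply: (pfilter_max AF n).
Qed.

(** The least pair, available at every point, settles the backward half of the Egli-Milner order for
    the tensor. *)
Lemma tens_rel_bot z h : tens_rel z (Pbot h) (Pbot h).
Proof.
case: z => [h'|w|h'] /=; rewrite ?(bool_irrelevance h' h).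
- by [].
- split=> // a b -> ->; rewrite tensx1 //; exact: filter_one (pfilterP w).
- exact: Or31.
Qed.

Lemma tens_rel_mono z z' x y : (z <= z')%O -> tens_rel z x y -> tens_rel z' x y.
Proof.
case: z z' => [h|w|h] [h'|w'|h'] //=.
- by rewrite (bool_irrelevance h' h).
- move=> _ [-> ->]; exact: (tens_rel_bot (Pin w')).
- by rewrite (bool_irrelevance h' h) => _ [-> _]; exact: Or31.
- move=> ww' [xw yw H]; split; [exact: le_trans ww'|exact: le_trans ww'|].
  by move=> a b xa yb; have /asboolP := ww'; apply; exact: H.
- by move=> _ ?; apply: Or33; exists w.
- by rewrite (bool_irrelevance h' h).
Qed.

Section Arrow.
Variables (imp : A -> A -> A) (impP : is_implication imp).

(** The greatest pair once the antecedent is reversed; at a prime filter it is present because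
    [imp I c] lies below [c]. *)
Lemma arrow_rel_bot_top z h : arrow_rel imp z (Pbot h) (Ptop h).
Proof.
case: z => [h'|w|h'] //=; last by rewrite (bool_irrelevance h' h).
exists w; split=> // a c wac /= aI; move: wac; rewrite aI.
apply: (filter_le (pfilterP w)); exact: imp1.
Qed.

(** A larger point contains more implications and so has fewer pairs. Besides the backward
    Egli-Milner half, this yields FC3 and FC4. *)
Lemma arrow_rel_anti z z' x y : (z <= z')%O -> arrow_rel imp z' x y ->
  exists x' y', [/\ arrow_rel imp z x' y', (x <= x')%O & (y' <= y)%O].
Proof.
case: z z' => [h|w|h] [h'|w'|h'] //=.
- by move=> _ xy; exists x, y.
- by move=> _ /(@arrow_rel_le imp (Pin w')) xy; exists x, y.
- by move=> _ [-> ->]; exists (Pbot h), (Ptop h').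
- move=> /asboolP ww' [w0 [xw0 w0y H]]; exists x, y; split=> //.
  by exists w0; split=> // a c /ww'; exact: H.
- move=> _ [-> ->]; exists (Pbot h'), (Ptop h'); split=> //.
  exact: (arrow_rel_bot_top (Pin w)).
- move=> _ [-> ->]; exists (Pbot h), (Ptop h).
  by rewrite (bool_irrelevance h h').
Qed.

(** The pair [(Pbot, Ptop)] dominates all others; for BA, where it is absent, [z] and [z']
    coincide. *)
Lemma arrow_rel_ext z z' x y : (z <= z')%O -> arrow_rel imp z x y ->
  exists x' y', [/\ arrow_rel imp z' x' y', (x' <= x)%O & (y <= y')%O].
Proof.
have ext (h : ~~ boolean C) : exists x' y',
    [/\ arrow_rel imp z' x' y', (x' <= x)%O & (y <= y')%O].
  exists (Pbot h), (Ptop h); split; first exact: arrow_rel_bot_top.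
    by [].
  by case: (y).
case: z z' ext => [h|w|h] z' ext zz'; do ?by move=> _; exact: ext h.
case: z' ext zz' => [h|w'|h] ext //; do ?by move=> _ _; exact: ext h.
move=> ww' wxy; case/boolP: (boolean C) => [n|h]; last exact: ext h.
by exists x, y; rewrite -(canon_discrete n ww').
Qed.

End Arrow.

(* The pairs making FC6, respectively FC5, valid. *)
Lemma tens_under_rel z x y : tens_rel z x y -> arrow_rel (@under C A) y x z.
Proof.
case: y => [h|w|h] zxy.
- by have [] := tens_rel_le zxy.
(* With [a] in [x] and [under a c] in [w], their tensor is in [w'], and FC6 in the algebra gives [c]
   in [w']. *)
- have in_rel w' : tens_in w' x (Pin w) ->
      arrow_rel (@under C A) (Pin w) x (Pin w').
    move=> [xw' _ H]; exists w'; split=> // a c wac xa.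
    by apply: (filter_le (pfilterP w') (tens_under_le AF c a)); exact: H.
  case: z zxy => [h [_ //]|w' /in_rel //|h [->|//|[w' /in_rel H]]].
    exact: (arrow_rel_bot_top (under_implication AF)).
  exact: arrow_rel_up H.
- case: z zxy => [h' [_ //]|w' [_ //]|h' [-> /=|//|[w' [_ //]]]].
  by rewrite (bool_irrelevance h' h).
Qed.

Lemma tens_over_rel z x y : tens_rel z x y -> arrow_rel overC x y z.
Proof.
case: x => [h|w|h] zxy.
- by have [] := tens_rel_le zxy.
- have in_rel w' : tens_in w' (Pin w) y -> arrow_rel overC (Pin w) y (Pin w').
    move=> [_ yw' H]; exists w'; split=> // a c wac ya.
    by apply: (filter_le (pfilterP w') (tens_over_le AF c a)); exact: H.
  case: z zxy => [h [//]|w' /in_rel //|h [//|->|[w' /in_rel H]]].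
    exact: (arrow_rel_bot_top (over_implication AF)).
  exact: arrow_rel_up H.
- case: z zxy => [h' [//]|w' [//]|h' [//|-> /=|[w' [//]]]].
  by rewrite (bool_irrelevance h' h).
Qed.

(** For FC1: as [I] holds everywhere, any partner will do. It is [Pbot] when available, and for BA
    the point itself. *)
Lemma tens_rel_self z :
  (exists y, tens_rel z z y) /\ (exists x, tens_rel z x z).
Proof.
have in_self w y : (y <= Pin w)%O ->
    (forall a b, (w : set A) a -> elements y b ->
      (w : set A) (tens a b) /\ (w : set A) (tens b a)) ->
    tens_in w (Pin w) y /\ tens_in w y (Pin w).
  by move=> yw H; split; split=> // a b ? ?; [case: (H a b) | case: (H b a)].
case: z => [h|w|h].
- by split; exists (Pbot h).
- case/boolP: (boolean C) => [n|h].
    have [] := in_self w (Pin w); last by split; exists (Pin w).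
      by [].
    by move=> a b wa wb; split; apply: (prime_tens_diag AF n).
  have [] := in_self w (Pbot h); last by split; exists (Pbot h).
    by [].
  by move=> a b wa ->; rewrite tensx1 // tens1x.
- by split; exists (Pbot h); [apply: Or32 | apply: Or31].
Qed.

Lemma canon_coalgebra : is_coalgebra canon_coalg.
Proof.
move=> z z' zz'; split=> //=.
- split=> [[x y] zxy|[x y] zxy] /=.
    by exists (x, y) => //=; exact: tens_rel_mono zxy.
  case/boolP: (boolean C) => [n|h].
    by exists (x, y) => //=; rewrite (canon_discrete n zz').
  by exists (Pbot h, Pbot h) => //; exact: tens_rel_bot.
- split=> [[x y] zxy|[x y] zxy] /=.
    have [x' [y' [H xx' yy']]] := arrow_rel_ext (under_implication AF) zz' zxy.
    by exists (x', y') => //; apply/andP.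
  have [x' [y' [H xx' yy']]] := arrow_rel_anti (under_implication AF) zz' zxy.
  by exists (x', y') => //; apply/andP.
- split=> [[x y] zxy|[x y] zxy] /=.
    have [y' [x' [H yy' xx']]] := arrow_rel_ext (over_implication AF) zz' zxy.
    by exists (x', y') => //; apply/andP.
  have [y' [x' [H yy' xx']]] := arrow_rel_anti (over_implication AF) zz' zxy.
  by exists (x', y') => //; apply/andP.
Qed.

Lemma canon_validates : validates_FC C canon_coalg.
Proof.
move=> ax FCax v vup; case: ax / FCax => /=.
- apply/seteqP; split=> [z [x [y [/tens_rel_le[xz _] vx _]]]|z vz] /=.
    exact: vup vx.
  by have [[y zy] _] := tens_rel_self z; exists z, y.
- apply/seteqP; split=> [z [x [y [/tens_rel_le[_ yz] _ vy]]]|z vz] /=.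
    exact: vup vy.
  by have [_ [x zx]] := tens_rel_self z; exists x, z.
- by move=> z _ x y /= /arrow_rel_le xy; exact: vup.
- by move=> z _ x y /= /arrow_rel_le xy; exact: vup.
(* FC3: as [y] is below [z], the pair [(s, t)] yields a pair [(s', t')] of [y] with [s] below [s']
   and [t'] below [t]. Persistence carries [b] from [s2] through [s] to [s'], and [c] from [t'] to
   [t]. FC4 is the mirror image. *)
- move=> z [x [y [zxy _ ybc]]] s t zst [s1 [s2 [ss _ bs2]]].
  have [_ yz] := tens_rel_le zxy; have [_ s2s] := tens_rel_le ss.
  have [s' [t' [yst ss' tt']]] := arrow_rel_anti (under_implication AF) yz zst.
  apply: (vup _ _ _ tt'); apply: (ybc _ _ yst); apply: (vup _ _ _ ss').
  exact: vup bs2.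
- move=> z [x [y [zxy xcb _]]] t s zts [s1 [s2 [ss _ bs2]]].
  have [xz _] := tens_rel_le zxy; have [_ s2s] := tens_rel_le ss.
  have [s' [t' [xst ss' tt']]] := arrow_rel_anti (over_implication AF) xz zts.
  apply: (vup _ _ _ tt'); apply: (xcb _ _ xst); apply: (vup _ _ _ ss').
  exact: vup bs2.
- move=> z [x [y [zxy xab yb]]]; apply: (xab _ _ _ yb); exact: tens_over_rel.
- move=> z [x [y [zxy xb yba]]]; apply: (yba _ _ _ xb); exact: tens_under_rel.
Qed.

(** * The truth lemma at prime filters *)

Section Truth.
Variables (V : Type) (h : form_alg C V -> A) (hP : is_hom h).

Definition canon_val (p : V) : set (cpoint A) :=
  [set z | match z with
    | Pbot _ => False
    | Pin w => (w : set A) (h (Var p))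
    | Ptop _ => True
  end].

Lemma canon_valP : is_valuation canon_val.
Proof.
by move=> p [?|w|?] [?|w'|?] //= /asboolP ww'; exact: ww'.
Qed.

Let up s := @interp_up C V _ _ canon_coalg canon_val s
  canon_discrete canon_coalgebra canon_valP.

Let truth_in (s : form C V) := forall w,
  interp canon_coalg canon_val s (Pin w) <-> (w : set A) (h s).

(** At [Pbot], persistence carries [s] to every prime filter, so [h s] lies in all of them and must
    be [I]. *)
Lemma truth_elements s x w : truth_in s -> (x <= Pin w)%O ->
  interp canon_coalg canon_val s x -> elements x (h s).
Proof.
move=> IH; case: x => [b|w0|b] //= _ sx; last exact/IH.
apply: (one_separation AF) => w1; apply/IH; exact: up sx.
Qed.

Lemma truth_arrow imp (a c : form C V) w :
  is_implication imp -> truth_in a -> truth_in c ->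
  (forall x y, arrow_rel imp (Pin w) x y ->
     interp canon_coalg canon_val a x -> interp canon_coalg canon_val c y)
  <-> (w : set A) (imp (h a) (h c)).
Proof.
move=> impP IHa IHc; split=> [H|wac x y [w0 [xw0 w0y K]] ax]; last first.
  (* The consequent is obtained at the intermediate prime filter [w0] and persists to [y], which may
     be [Ptop]. *)
  by apply: (up w0y); apply/IHc; apply: K wac _; exact: truth_elements xw0 ax.
apply: contrapT => /(prime_imp AF impP) [x [y [xa yc K]]].
apply: yc; apply/IHc; apply: (H (Pin x)); last exact/IHa.
(* [y] is its own intermediate filter, and it includes [x] because [imp b b] is above [I], hence in
   [w]. *)
exists y; split=> //; apply/asboolP => b xb; apply: K xb.
exact: (filter_le (pfilterP w) (impxx impP b) (filter_one (pfilterP w))).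
Qed.

Lemma truth (s : form C V) : truth_in s.
Proof.
elim: s => [p|a IHa b IHb|a IHa b IHb|b|b|n a IHa|
  |a IHa b IHb|a IHa c IHc|c IHc b IHb] w /=; have wP := pfilterP w.
- by [].
- rewrite (hom_meet hP); split=> [[/IHa wa /IHb wb]|wab].
    exact: (filter_meet wP).
  split; [apply/IHa | apply/IHb]; apply: (filter_le wP _ wab).
    exact: alg_leIl.
  exact: alg_leIr.
- rewrite (hom_join hP); split=> [[/IHa|/IHb]|/(prime_join wP) [/IHa|/IHb]].
  + by apply: (filter_le wP); exact: alg_leUl.
  + by apply: (filter_le wP); exact: alg_leUr.
  + by left.
  + by right.
- rewrite (hom_top hP); split=> // _.
  by apply: (filter_le wP _ (filter_one wP)); exact: alg_lex1.
- by rewrite (hom_bot hP); split=> // /(prime_bot wP).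
- rewrite (hom_neg hP) prime_neg //; split=> [na wa|na /IHa //].
  by apply: na; apply/IHa.
- by rewrite (hom_one hP); split=> // _; exact: (filter_one wP).
- rewrite (hom_tens hP); split.
    move=> [x [y [[xw yw H] ax by']]]; apply: H.
      exact: truth_elements xw ax.
    exact: truth_elements yw by'.
  move=> /(prime_tens AF) [x [y [xa yb H]]]; exists (Pin x), (Pin y).
  (* Both filters lie below [w]: a member [c] of one is its tensor with [I], a member of the
     other. *)
  split; [|exact/IHa|exact/IHb]; split=> //; apply/asboolP => c.
    move=> xc; rewrite -(tensx1 AF c); apply: H => //.
    exact: filter_one (pfilterP y).
  move=> yc; rewrite -(tens1x AF c); apply: H => //.
  exact: filter_one (pfilterP x).
- by rewrite (hom_under hP); exact: truth_arrow (under_implication AF) _ _.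
- rewrite (hom_over hP); have := truth_arrow w (over_implication AF) IHb IHc.
  move=> [H K]; split=> [H'|/K H' x y]; last exact: H'.
  by apply: H => x y; exact: H'.
Qed.

End Truth.

End Canonical.

(** * Separating a consistent pair of theories by a prime filter *)

Section Separation.
Variables (C : base) (V : Type) (A : alg C) (AF : is_FC_algebra A).
Variables (h : form_alg C V -> A) (hP : is_hom h).

Let O := LRL_object (FC_LRL AF).

Lemma form_bigmeet_le (X : seq (form C V)) (hX : admissible C X) a :
  List.In a X -> le_alg (h (form_bigmeet hX)) (h a).
Proof.
case: X hX => //= x X _.
elim: X => [|y X IH] /=; first by case=> // ->; exact: alg_lexx.
rewrite (hom_meet hP) => aX.
have [<-|/IH] : y = a \/ x = a \/ List.In a X by tauto.
  exact: alg_leIl.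
apply: (alg_le_trans O); exact: alg_leIr.
Qed.

Lemma form_bigjoin_ge (X : seq (form C V)) (hX : admissible C X) a :
  List.In a X -> le_alg (h a) (h (form_bigjoin hX)).
Proof.
case: X hX => //= x X _.
elim: X => [|y X IH] /=; first by case=> // ->; exact: alg_lexx.
rewrite (hom_join hP) => aX.
have [<-|/IH aXle] : y = a \/ x = a \/ List.In a X by tauto.
  exact: alg_leUl.
apply: (alg_le_trans O aXle); exact: alg_leUr.
Qed.

(** Consistency makes the filter generated by [Phi] disjoint from the ideal generated by [Psi], so
    prime extension applies. *)
Lemma theory_separation (Phi Psi : set (form C V)) :
  (~~ bounded C -> Phi !=set0) ->
  ~ (exists (Phi0 Psi0 : seq (form C V))
            (hPhi : admissible C Phi0) (hPsi : admissible C Psi0),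
      [/\ forall a, List.In a Phi0 -> Phi a,
          forall b, List.In b Psi0 -> Psi b
        & le_alg (h (form_bigmeet hPhi)) (h (form_bigjoin hPsi))]) ->
  exists w : pfilter A, (forall a, Phi a -> (w : set A) (h a)) /\
    (forall b, Psi b -> ~ (w : set A) (h b)).
Proof.
move=> Phi0N consistent.
pose F : set A := [set x | exists X : seq (form C V),
  (forall a, List.In a X -> Phi a) /\
  (forall z, (forall a, List.In a X -> le_alg z (h a)) -> le_alg z x)].
pose G : set A := [set x | exists X : seq (form C V), [/\ admissible C X,
  (forall b, List.In b X -> Psi b) &
  (forall z, (forall b, List.In b X -> le_alg (h b) z) -> le_alg x z)]].
have [||||w [Fw wG]] := @prime_extension C A AF F G.
- split=> [|x y xy [X [XPhi Xx]]|x y [X [XPhi Xx]] [Y [YPhi Yy]]].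
  + by exists [::]; split=> // z _; exact: le_one.
  + by exists X; split=> // z /Xx zx; exact: (alg_le_trans O zx).
  + exists (X ++ Y); split=> [a /List.in_app_iff [/XPhi|/YPhi]//|z zXY].
    by apply: (alg_lexI O); [apply: Xx | apply: Yy] => a aXY; apply: zXY;
      apply/List.in_app_iff; [left | right].
- move=> x [X [XPhi Xx]] [Y [Yadm YPsi Yx]]; apply: consistent.
  (* For DL the empty sequence has no meet, so a member of [Phi] is put in front of [X]. *)
  have [X' [X'adm X'Phi XX']] : exists X', [/\ admissible C X',
      (forall a, List.In a X' -> Phi a) &
      forall a, List.In a X -> List.In a X'].
    case/boolP: (bounded C) => [b|/Phi0N [p Phip]]; first by exists X; split.
    by exists (p :: X); split=> //= a; [case=> [<-//|/XPhi] | right].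
  exists X', Y, X'adm, Yadm; split=> //; apply: (alg_le_trans O (y := x)).
    by apply: Xx => a /XX'; exact: form_bigmeet_le.
  by apply: Yx => b; exact: form_bigjoin_ge.
- move=> x y [X [Xadm XPsi Xx]] [Y [Yadm YPsi Yy]].
  exists (X ++ Y); split=> [|b /List.in_app_iff [/XPsi|/YPsi]//|z zXY].
    by case: (X) (Y) Xadm Yadm => [|? ?] [|? ?].
  by apply: (alg_leUx O); [apply: Xx | apply: Yy] => a aXY; apply: zXY;
    apply/List.in_app_iff; [left | right].
- by move=> b; exists [::]; split=> // z _; exact: alg_le0x.
exists w; split=> [a Phia|b Psib wb].
  by apply: Fw; exists [:: a]; split=> [b [<-|]//|z]; apply; left.
by apply: wG wb _; exists [:: b]; split=> // [c [<-|]//|z]; apply; left.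
Qed.

End Separation.

Theorem theorem5 (C : base) (V : Type) (Phi Psi : set (form C V)) :
  (~~ bounded C -> Phi !=set0) ->
  ~ (exists (Phi0 Psi0 : seq (form C V))
            (hPhi : admissible C Phi0) (hPsi : admissible C Psi0),
      [/\ forall a, List.In a Phi0 -> Phi a,
          forall b, List.In b Psi0 -> Psi b
        & le_alg (class_FC (form_bigmeet hPhi))
                 (class_FC (form_bigjoin hPsi))]) ->
  exists (d : Order.disp_t) (W : porderType d) (g : W -> TRL W),
    [/\ boolean C -> discrete_order W,
        is_coalgebra g,
        validates_FC C g
      & exists (v : V -> set W) (w : W),
        [/\ is_valuation v,
            forall a, Phi a -> interp g v a w
          & forall b, Psi b -> ~ interp g v b w]].
Proof.
move=> PhiN consistent; have AF := L_FC_is_FC_algebra C V.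
have hP : is_hom (@class_FC C V : form_alg C V -> L_FC C V).
  have [H K] := (proj_hom (LRL_cong C V), proj_hom (FC_cong C V)).
  by split=> *; rewrite /class_FC ?(hom_meet H, hom_join H, hom_top H,
    hom_bot H, hom_neg H, hom_one H, hom_tens H, hom_under H, hom_over H)
    ?(hom_meet K, hom_join K, hom_top K, hom_bot K, hom_neg K, hom_one K,
    hom_tens K, hom_under K, hom_over K).
have [w [wPhi wPsi]] := theory_separation AF hP PhiN consistent.
exists (Order.Disp tt tt), (cpoint (L_FC C V)), (@canon_coalg C (L_FC C V)).
split; [exact: canon_discrete | exact: canon_coalgebra
  | exact: canon_validates |].
exists (canon_val (@class_FC C V : form_alg C V -> _)), (Pin w); split.
- exact: canon_valP.
- by move=> a /wPhi wa; apply/(truth AF hP).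
- by move=> b /wPsi wb /(truth AF hP).
Qed.
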